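(* Let $u\ge 0$ be a solution of the Cauchy problem $$\rho(x)u_t-\operatorname{div}\big(u^{m-1}|\nabla u|^{p-2}\nabla u\big)=0,\quad x\in M,\ t>0;\qquad u(x,0)=u_0(x),\quad x\in M,$$ with $u_0\ge 0$, $\rho u_0\in L^1(M)$ and $\operatorname{supp}u_0\subset B_{R_0}$ for a given $R_0>0$. Assume that for some $\bar t>0$ and some $\bar R>R_0$ $$\operatorname{supp}u(t)\subset B_{\bar R}\qquad\text{for } 0<t<\bar t .$$ Then $$\|u(t)\rho\|_{L^1(M)}=\|u_0\rho\|_{L^1(M)}\qquad\text{for } 0<t<\bar t .$$
   Context: Standing setting. $M$ is a Riemannian manifold of topological dimension $N$ with infinite volume; $\mu$ is its Riemannian measure, $|\cdot|_{N-1}$ the corresponding $(N-1)$-dimensional Hausdorff measure, $x_0\in M$ is a fixed point, $d(x)$ is the Riemannian distance from $x$ to $x_0$, $B_R=\{x\in M: d(x)<R\}$, $V(R)=\mu(B_R)$, and $V^{(-1)}$ is the inverse function of $V$. The real parameters satisfy $N>p>1$, $p+m>3$. The density $\rho$ is a globally bounded, strictly positive, nonincreasing function of $d(x)$; one writes $\rho(x)=\rho(d(x))$. Constants $C>1$, $c>0$ below are given and may differ from line to line. It is assumed that: (i) there is a nondecreasing function $g$ with $|\partial U|_{N-1}\ge g(\mu(U))$ for all open bounded Lipschitz $U\subset M$, and $\omega(v)=v^{(N-1)/N}/g(v)$, $v>0$, $\omega(0)=\lim_{v\to0+}\omega(v)$, is continuous and nondecreasing; (ii) $V(2R)\le C\,V(R)$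 for all $R>0$; (iii) $g(V(R))\ge c\,V(R)/R$ for all $R>0$; (iv) $\int_0^s V^{(-1)}(\tau)^{-p}\,d\tau\le C\, s\,V^{(-1)}(s)^{-p}$ for all $s>0$; (v) $\rho(2R)\ge C^{-1}\rho(R)$ for all $R>0$. ''Solution'' means nonnegative weak solution in the standard (local energy) sense for doubly degenerate parabolic equations: the equation holds in integral form against test functions of bounded support (in particular finitely supported cutoff functions are admissible), and the initial datum is attained in the weak sense. *)

(* Defs.v *)
From HB Require Import structures.
From mathcomp Require Import all_boot all_order all_algebra.
From mathcomp Require Import all_classical all_reals all_analysis.
Set Implicit Arguments.
Unset Strict Implicit.
Unset Printing Implicit Defensive.
Import Order.TTheory GRing.Theory Num.Theory.
Import numFieldNormedType.Exports.
Local Open Scope classical_set_scope.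
Local Open Scope ring_scope.

(* The partial derivatives of order <= k exist and are continuous on O;
   only used for O open. *)
Fixpoint Ck_on (R : realType) (n k : nat) (O : set 'rV[R]_n)
    (f : 'rV[R]_n -> R) : Prop :=
  {within O, continuous f} /\
  if k is k'.+1 then
    forall a : 'I_n, (forall y, O y -> derivable f y (delta_mx 0 a)) /\
      Ck_on k' O (fun y => 'D_(delta_mx 0 a) f y)
  else True.

Definition smooth_on (R : realType) (n : nat) (O : set 'rV[R]_n)
    (f : 'rV[R]_n -> R) : Prop := forall k, Ck_on k O f.

(* Connected Riemannian manifolds without boundary. The index type of the
   atlas is [chart]; [param i] is the inverse of the chart map [coord i].
   [metric i x] is the Gram matrix at the point x of the manifold of the
   coordinate frame of chart i. Tangent vectors are rows, so that a change of
   chart is v |-> v *m jacobian. *)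
Record riemannian_manifold (R : realType) (N : nat) := RiemannianManifold {
  rm_sort :> ptopologicalType ;
  rm_hausdorff : hausdorff_space rm_sort ;
  rm_second_countable : @second_countable rm_sort ;
  rm_connected : connected [set: rm_sort] ;
  chart : Type ;
  dom : chart -> set rm_sort ;
  coord : chart -> rm_sort -> 'rV[R]_N ;
  param : chart -> 'rV[R]_N -> rm_sort ;
  chart_at : rm_sort -> chart ;
  dom_open : forall i, open (dom i) ;
  codom_open : forall i, open (coord i @` dom i) ;
  chart_at_dom : forall x, dom (chart_at x) x ;
  coordK : forall i x, dom i x -> param i (coord i x) = x ;
  coord_continuous : forall i, {within dom i, continuous (coord i)} ;
  param_continuous :
    forall i, {within coord i @` dom i, continuous (param i)} ;
  transition_smooth : forall i j (b : 'I_N),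
    smooth_on (coord i @` (dom i `&` dom j))
              (fun y => coord j (param i y) 0 b) ;
  metric : chart -> rm_sort -> 'M[R]_N ;
  metric_smooth : forall i (a b : 'I_N),
    smooth_on (coord i @` dom i) (fun y => metric i (param i y) a b) ;
  metric_sym : forall i x, dom i x -> (metric i x)^T = metric i x ;
  metric_pos : forall i x (v : 'rV[R]_N), dom i x -> v != 0 ->
    0 < (v *m metric i x *m v^T) 0 0 ;
  metric_transition : forall i j x, dom i x -> dom j x ->
    let J := jacobian (coord j \o param i) (coord i x) in
    metric i x = J *m metric j x *m J^T }.

Arguments dom {R N M} i : rename.
Arguments coord {R N M} i x : rename.
Arguments param {R N M} i y : rename.
Arguments chart_at {R N M} x : rename.
Arguments metric {R N M} i x : rename.

(* C^1 arc from x to y of length l inside the domain of one chart; c is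
   defined on the whole line, but only its restriction to [0, 1] matters. *)
Definition c1_arc (R : realType) (N : nat) (M : riemannian_manifold R N)
    (x y : M) (l : R) : Prop :=
  exists (i : chart M) (c : R -> 'rV[R]_N),
    [/\ (forall t : R, derivable c t 1) /\ continuous (derive1 c),
        forall t : R, 0 <= t <= 1 -> (coord i @` dom i) (c t),
        param i (c 0) = x, param i (c 1) = y &
        l = \int[@lebesgue_measure R]_(t in `[0, 1])
              Num.sqrt ((derive1 c t *m metric i (param i (c t)) *m (derive1 c t)^T)
                          0 0)].

(* Every piecewise C^1 curve is a finite concatenation of such arcs. *)
Inductive curve_of_length (R : realType) (N : nat)
    (M : riemannian_manifold R N) : M -> M -> R -> Prop :=
| curve_nil x : curve_of_length x x 0
| curve_cons x y z l1 l2 : c1_arc x y l1 -> curve_of_length y z l2 ->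
    curve_of_length x z (l1 + l2).

Section geometry.
Context (R : realType) (N : nat) (M : riemannian_manifold R N).

Definition rdist (x y : M) : R := inf [set l | curve_of_length x y l].

Definition rball (x0 : M) (r : R) : set M := [set x | rdist x0 x < r].

(* Volume of the unit ball of R^k. *)
Fixpoint ball_volume (k : nat) : R :=
  match k with
  | 0 => 1
  | 1 => 2
  | k'.+2 => 2 * pi / k%:R * ball_volume k'
  end.

Definition diam (A : set M) : R :=
  sup [set r | r = 0 \/ exists x y, [/\ A x, A y & r = rdist x y]].

Definition hausdorff_content (k : nat) (delta : R) (S : set M) : \bar R :=
  ereal_inf
    [set (\sum_(n <oo) (ball_volume k * (diam (A n) / 2) ^+ k)%:E)%E |
      A in [set A : nat -> set M | S `<=` \bigcup_n A n /\
        forall n x y, A n x -> A n y -> rdist x y <= delta]].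

Definition hausdorff_measure (k : nat) (S : set M) : \bar R :=
  ereal_sup [set hausdorff_content k delta S | delta in [set d : R | 0 < d]].

Definition frontier (U : set M) : set M := closure U `\` interior U.

(* Near each of its boundary points, U is, after a linear change of the chart
   coordinates, the region strictly below the graph of a Lipschitz function.
   This does not depend on the chart. *)
Definition lipschitz_open (U : set M) : Prop :=
  open U /\ forall x, frontier U x ->
    exists (A : 'M[R]_N) (j : 'I_N) (f : 'rV[R]_N.-1 -> R) (L : R)
           (W : set 'rV[R]_N),
      [/\ A \in unitmx,
          forall y z, `|f y - f z| <= L * `|y - z|,
          open W /\ W (coord (chart_at x) x),
          W `<=` coord (chart_at x) @` dom (chart_at x) &
          forall y, W y -> (U (param (chart_at x) y) <->
            (y *m A) 0 j < f (col' j (y *m A)))].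

Definition borel := g_sigma_algebraType (@open M).

(* Lebesgue integral over R^n, as an iterated integral. *)
Fixpoint rV_integral (n : nat) : ('rV[R]_n -> \bar R) -> \bar R :=
  match n with
  | 0 => fun f => f 0
  | n'.+1 => fun f => (\int[@lebesgue_measure R]_s
      rV_integral (fun y : 'rV[R]_n' => f (row_mx (s%:M : 'rV[R]_1) y)))%E
  end.

Definition vol_density (i : chart M) (x : M) : R :=
  Num.sqrt (\det (metric i x)).

Definition riemannian_measure (mu : {measure set borel -> \bar R}) : Prop :=
  forall (i : chart M) (A : set borel), measurable A -> A `<=` dom i ->
    mu A = rV_integral (fun y : 'rV[R]_N =>
      (\1_(coord i @` A) y * vol_density i (param i y))%:E).

(* A covector field is given by its components in all charts. Differentials
   are used instead of gradients: |du| = |grad u| and <du, dv> =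
   <grad u, grad v>. *)
Definition covectors := chart M -> M -> 'rV[R]_N.

Definition covector_field (w : covectors) : Prop :=
  forall i j x, dom i x -> dom j x ->
    w i x = w j x *m (jacobian (coord j \o param i) (coord i x))^T.

Definition codot (v w : covectors) (x : M) : R :=
  (v (chart_at x) x *m invmx (metric (chart_at x) x) *m
    (w (chart_at x) x)^T) 0 0.

Definition conorm (w : covectors) (x : M) : R := Num.sqrt (codot w w x).

(* Pointwise differential; it is used for Lipschitz functions, which are
   differentiable almost everywhere. *)
Definition differential (f : M -> R) : covectors := fun i x =>
  \row_(a < N) 'D_(delta_mx 0 a) (f \o param i) (coord i x).

Section measure.
Variable mu : {measure set borel -> \bar R}.

(* w is the weak differential of f: integration by parts in each chart, where
   Lebesgue measure is dmu / vol_density. *)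
Definition weak_differential (f : M -> R) (w : covectors) : Prop :=
  forall (i : chart M) (a : 'I_N),
    (forall K : set borel, @compact M K -> K `<=` dom i ->
       mu.-integrable K (EFin \o f) /\
       mu.-integrable K (fun x => (w i x 0 a)%:E)) /\
    forall h : 'rV[R]_N -> R, smooth_on setT h ->
      (exists2 K, compact K /\ K `<=` coord i @` dom i &
                  forall y, ~ K y -> h y = 0) ->
      \int[mu]_(x in dom i)
        (f x * 'D_(delta_mx 0 a) h (coord i x) / vol_density i x) =
      - \int[mu]_(x in dom i)
        (w i x 0 a * h (coord i x) / vol_density i x).

(* Spatial gradient of a nonnegative function u(t, x). As usual for doubly
   degenerate equations, u itself need not be weakly differentiable where it
   is close to 0, and Du is defined by the truncations of u, with Du = 0
   where u = 0. If u(t) is in W^{1,1}_loc this is its weak gradient. *)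
Definition spatial_gradient (u : R -> M -> R) (Du : R -> covectors) : Prop :=
  [/\ forall t : R, 0 < t -> covector_field (Du t),
      forall (i : chart M) (a : 'I_N),
        measurable_fun [set z : measurableTypeR R * borel | 0 < z.1 /\ dom i z.2]
          (fun z => Du z.1 i z.2 0 a),
      forall t i x, 0 < t -> dom i x -> u t x = 0 -> Du t i x = 0 &
      {ae @lebesgue_measure R, forall t : R, 0 < t ->
        forall k l : R, 0 < k -> k < l ->
          weak_differential
            (fun x => Num.min (Num.max (u t x) k) l)
            (fun i x => if k < u t x < l then Du t i x else 0)}].

Variable x0 : M.

Definition volume (r : R) : \bar R := mu (rball x0 r).

Definition bounded_support (f : M -> R) : Prop :=
  exists r : R, forall x, r <= rdist x0 x -> f x = 0.

Definition space_test (z : M -> R) : Prop :=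
  (exists L : R, forall x y, `|z x - z y| <= L * rdist x y) /\ bounded_support z.

Definition spacetime_test (eta : R -> M -> R) : Prop :=
  (exists L : R, forall s t x y,
     `|eta s x - eta t y| <= L * (`|s - t| + rdist x y)) /\
  exists r : R, forall t x, r <= rdist x0 x -> eta t x = 0.

(* Nonnegative weak solutions of
     rho u_t - div (u^(m-1) |grad u|^(p-2) grad u) = 0,  u(0) = u0,
   on M x (0, +oo): rho u is in C((0, +oo); L^1_loc), the energy
   u^(m-1) |grad u|^p and the flux are in L^1_loc, where "loc" refers to the
   sets B_r x [t1, t2] with 0 < t1. *)
Definition weak_solution (p m : R) (rho u0 : M -> R) (u : R -> M -> R) :
    Prop :=
  [/\ forall t x, 0 < t -> 0 <= u t x,
      measurable_fun [set z : measurableTypeR R * borel | 0 < z.1]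
        (fun z => u z.1 z.2),
      forall r t : R, 0 < t ->
        mu.-integrable (rball x0 r) (fun x => (rho x * u t x)%:E) /\
        (\int[mu]_(x in rball x0 r) (rho x * `|u s x - u t x|)%:E)%E
          @[s --> t] --> 0%E,
      exists Du : R -> covectors,
        [/\ spatial_gradient u Du,
            forall r t1 t2 : R, 0 < t1 -> t1 < t2 ->
              (\int[@lebesgue_measure R]_(t in `[t1, t2])
                 \int[mu]_(x in rball x0 r)
                   (u t x `^ (m - 1) * conorm (Du t) x `^ p)%:E < +oo)%E,
            forall r t1 t2 : R, 0 < t1 -> t1 < t2 ->
              (\int[@lebesgue_measure R]_(t in `[t1, t2])
                 \int[mu]_(x in rball x0 r)
                   (u t x `^ (m - 1) * conorm (Du t) x `^ (p - 1))%:E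
                 < +oo)%E &
            forall eta t1 t2, spacetime_test eta -> 0 < t1 -> t1 < t2 ->
              \int[mu]_x (rho x * u t2 x * eta t2 x)
              + \int[@lebesgue_measure R]_(t in `[t1, t2]) \int[mu]_x
                  (- (rho x * u t x * derive1 (eta ^~ x) t)
                   + u t x `^ (m - 1) * conorm (Du t) x `^ (p - 2)
                     * codot (Du t) (differential (eta t)) x)
              = \int[mu]_x (rho x * u t1 x * eta t1 x)] &
      forall z, space_test z ->
        \int[mu]_x (rho x * u t x * z x) @[t --> 0^'+]
          --> \int[mu]_x (rho x * u0 x * z x)].

(* Closed support up to mu-null sets. *)
Definition ess_support (f : M -> R) : set M :=
  [set x | forall U : set borel, @open M U -> U x ->
     ~ mu.-negligible (U `&` [set y | f y != 0])].

Definition isoperimetric (g : R -> R) : Prop :=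
  forall U : set borel, lipschitz_open U ->
    (exists r : R, U `<=` rball x0 r) ->
    ((g (fine (mu U)))%:E <= hausdorff_measure N.-1 (frontier U))%E.

Definition inverse_volume (Vinv : R -> R) : Prop :=
  (forall r : R, 0 < r ->
     (volume r < +oo)%E /\ Vinv (fine (volume r)) = r) /\
  (forall s : R, 0 < s -> 0 < Vinv s /\ volume (Vinv s) = s%:E).

End measure.

Definition omega (g : R -> R) (v : R) : R :=
  let w s := s `^ ((N%:R - 1) / N%:R) / g s in
  if 0 < v then w v else lim (w s @[s --> 0^'+]).

End geometry.

(* Main.v *)
Require Import Defs.
From HB Require Import structures.
From mathcomp Require Import all_boot all_order all_algebra.
From mathcomp Require Import all_classical all_reals all_analysis.
From mathcomp Require Import unstable measurable_realfun lra.
Import Order.TTheory GRing.Theory Num.Theory.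
Import numFieldNormedType.Exports.
(* Gives back to [coord] the meaning of chart map, instead of coordinate of a
   vector in a basis. *)
Import Defs.
Local Open Scope classical_set_scope.
Local Open Scope ring_scope.

Set Implicit Arguments.
Unset Strict Implicit.
Unset Printing Implicit Defensive.

(** Test the equation with a cutoff zeta of the space variable alone that is 1
    on the ball of radius Rbar and has bounded support ([cutoff]). The term
    with the time derivative of zeta vanishes, and so does the flux term: where
    u = 0 the gradient of u is 0, and elsewhere, up to a null set, the point is
    in the open ball, where zeta is locally constant and its differential is 0
    ([flux_cutoff0]). Hence the integral of rho u(t) zeta is the same for all
    times t in (0, tbar) ([mass_cutoff_cst]), and the weak initial condition,
    tested with zeta, says that its limit at t = 0+ is the integral of
    rho u0 zeta. Finally rho u(t) zeta = rho u(t) and rho u0 zeta = rho u0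
    almost everywhere, because of the supports ([integral_cutoff]).

    Two points need care. The cutoff is a function of the distance to x0, and
    it is an admissible test function because the distance is 1-Lipschitz. The
    distance is an infimum of lengths of curves, so this rests on the connection
    of any two points by a curve: a point reaches a whole neighbourhood by
    segments drawn in one chart ([short_segment]), so the set of the points
    that can be reached is open and closed. The same segments bound the distance
    in terms of the coordinates and make the ball open ([near_param_rdist]).
    Besides, the integrand of the flux term involves the chart chosen at each
    point, so its measurability is not clear; an integral over the whole space is
    nevertheless unchanged by a modification on a null set
    ([ae_eq_integralT]), as it is a difference of two suprema over measurable
    simple functions. *)

(** * Integrals and null sets, without measurability *)

Section lower_integral.
Import HBNNSimple.

(** A simple function below f becomes a simple function below g of the same
    integral when it is set to 0 on a measurable null set; neither f nor g has
    to be measurable. *)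
Lemma ge0_ae_le_integral {d : measure_display} {T : measurableType d}
    {R : realType} (mu : {measure set T -> \bar R}) (f g : T -> \bar R) :
  (forall x, 0 <= f x)%E -> (forall x, 0 <= g x)%E ->
  {ae mu, forall x, (f x <= g x)%E} ->
  (\int[mu]_x f x <= \int[mu]_x g x)%E.
Proof.
move=> f0 g0 [A [mA muA0 fgA]].
rewrite !ge0_integralTE //; apply: ge_ereal_sup => _ [h hf <-].
pose h' : {nnsfun T >-> R} :=
  mul_nnsfun h (indic_nnsfun R (measurableC mA)).
have -> : sintegral mu h = sintegral mu h'.
  rewrite -!integralT_nnsfun; apply: ge0_ae_eq_integral => //.
  - exact/measurable_EFinP.
  - exact/measurable_EFinP.
  - by move=> x _; rewrite lee_fin.
  - by move=> x _; rewrite lee_fin.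
  exists A; split=> // x /= hh'; apply: contrapT => Ax; apply: hh' => _.
  by rewrite /= mindicE mem_set// mulr1.
apply: ereal_sup_ubound; exists h' => // x /=; rewrite mindicE.
have [Ax|Ax] := boolP (x \in ~` A).
  rewrite mulr1; apply: le_trans (hf x) _.
  move: Ax; rewrite inE /= => Ax; apply: contrapT => fg; apply: Ax.
  exact: fgA.
by rewrite mulr0.
Qed.

Lemma ae_eq_integralT {d : measure_display} {T : measurableType d}
    {R : realType} (mu : {measure set T -> \bar R}) (f g : T -> \bar R) :
  {ae mu, forall x, f x = g x} -> (\int[mu]_x f x = \int[mu]_x g x)%E.
Proof.
move=> fg; rewrite integralE [RHS]integralE.
by congr (_ - _)%E; apply/eqP; rewrite eq_le; apply/andP; split;
  apply: ge0_ae_le_integral => //; apply: filterS fg => x fgx;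
  rewrite ?funeposE ?funenegE fgx.
Qed.

End lower_integral.

Lemma ae_impl {d : measure_display} {T : measurableType d}
    {R : realType} (mu : {measure set T -> \bar R}) (P Q : T -> Prop) :
  {ae mu, forall x, P x} -> (forall x, P x -> Q x) -> {ae mu, forall x, Q x}.
Proof. by move=> Pae PQ; apply: filterS Pae. Qed.

(** * Essential support *)

(** The complement of the essential support is a union of open sets that meet
    the set where f is nonzero in a null set; they can be taken in a countable
    basis. *)
Lemma ae_zero_outside_ess_support {R : realType} {N : nat}
    (M : riemannian_manifold R N) (mu : {measure set (borel M) -> \bar R})
    (f : M -> R) :
  {ae mu, forall x, ~ ess_support mu f x -> f x = 0}.
Proof.
have [B cB [Bopen Bbase]] := rm_second_countable M.
have [code code_inj] := countable_injP _ cB.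
pose null (U : set (borel M)) := mu.-negligible (U `&` [set y | f y != 0]).
(* At most one basis set has code n; the union avoids choosing it. *)
pose F (n : nat) : set (borel M) :=
  \bigcup_(U in [set U | [/\ B U, code U = n & null U]])
     (U `&` [set y | f y != 0]).
suff nF : mu.-negligible (\bigcup_n F n).
  apply: (negligibleS _ nF).
  move=> x /= /not_implyP[xS /eqP fx0].
  move: xS; rewrite /ess_support /= -existsNE => -[U].
  move=> /not_implyP[oU /not_implyP[Ux /contrapT nU]].
  have [V [BV Vx] VU] := Bbase x U (open_nbhs_nbhs (conj oU Ux)).
  exists (code V) => //; exists V => //; split=> //.
  by apply: (negligibleS _ nU); apply: setSI.
apply: negligible_bigcup => n.
have [[U [BU Un nU]]|noU] := pselect (exists U, [/\ B U, code U = n & null U]).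
  apply: (negligibleS _ nU); move=> x [V [BV Vn nV] Vx].
  by rewrite (code_inj U V) ?inE// Un Vn.
apply: (negligibleS _ (negligible_set0 mu)) => x [V hV _].
by case: noU; exists V.
Qed.

(** * Lengths of curves *)

Lemma Rintegral_reverse {R : realType} (G : R -> R) :
  {within `[0, 1], continuous G} ->
  \int[lebesgue_measure]_(t in `[0, 1]) G t =
  \int[lebesgue_measure]_(t in `[0, 1]) G (onem t).
Proof.
move=> cG; have r01 : (0 : R) <= (1 : R) <= 1 by rewrite ler01 lexx.
by rewrite (Rintegration_by_substitution_onem r01 cG) onem1.
Qed.

Lemma cvg_sum_ord {R : realType} {T : Type} {F : set_system T}
    {FF : Filter F} n (f : 'I_n -> T -> R) (l : 'I_n -> R) :
  (forall i, f i x @[x --> F] --> l i) ->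
  \sum_i f i x @[x --> F] --> \sum_i l i.
Proof. by move=> fl; apply: cvg_big => //; exact: add_continuous. Qed.

Section curves.
Context {R : realType} {N : nat} {M : riemannian_manifold R N}.
Implicit Types (i : chart M) (x y z : M).

Lemma metric_continuous i (a b : 'I_N) (q : 'rV[R]_N) :
  (coord i @` dom i) q ->
  {for q, continuous (fun q => metric i (param i q) a b)}.
Proof.
move=> qi; have [+ _] := metric_smooth i a b 0%N.
rewrite continuous_open_subspace; last exact: codom_open.
by apply; rewrite inE.
Qed.

Lemma mx_quadratic_formE (v : 'rV[R]_N) (G : 'M[R]_N) :
  (v *m G *m v^T) 0 0 = \sum_j (\sum_k v 0 k * G k j) * v 0 j.
Proof. by rewrite mxE; apply: eq_bigr => j _; rewrite !mxE. Qed.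

Definition speed i (c : R -> 'rV[R]_N) (t : R) : R :=
  Num.sqrt ((derive1 c t *m metric i (param i (c t)) *m (derive1 c t)^T) 0 0).

Lemma speed_continuous i (c : R -> 'rV[R]_N) :
  (forall t : R, derivable c t 1) -> continuous (derive1 c) ->
  (forall t : R, 0 <= t <= 1 -> (coord i @` dom i) (c t)) ->
  {within `[0, 1], continuous (speed i c)}.
Proof.
move=> dc cc ci; apply: continuous_in_subspaceT => t.
rewrite inE /= in_itv /= => t01.
rewrite /speed; apply: continuous_comp; last exact: sqrt_continuous.
rewrite /prop_for /continuous_at mx_quadratic_formE.
under eq_fun do rewrite mx_quadratic_formE.
have ccoord k : {for t, continuous (fun t => derive1 c t 0 k)}.
  apply: (@continuous_comp _ _ _ (derive1 c) (fun v : 'rV[R]_N => v 0 k)).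
    exact: cc.
  exact: matrix_normedtype.coord_continuous.
apply: cvg_sum_ord => j; apply: cvgM; last exact: ccoord.
apply: cvg_sum_ord => k; apply: cvgM; first exact: ccoord.
have cct : {for t, continuous c}.
  by apply: differentiable_continuous; exact/derivable1_diffP.
apply: (@continuous_comp _ _ _ c (fun q => metric i (param i q) k j)) => //.
exact: metric_continuous (ci t t01).
Qed.

Lemma is_derive_reverse (c : R -> 'rV[R]_N) (t : R) :
  derivable c (onem t) 1 ->
  is_derive t 1 (c \o onem) (- derive1 c (onem t)).
Proof.
move=> dc.
have dif_c : differentiable c (onem t) by exact/derivable1_diffP.
have dif_1 : differentiable (@onem R) t.
  by apply/derivable1_diffP; exact: derivableB.
apply: DeriveDef.
  by apply/derivable1_diffP; exact: differentiable_comp.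
rewrite -derive1E derive1E'; last exact: differentiable_comp.
rewrite diff_comp //= -[X in 'd c _ X](derive1E' dif_1) derive1_onem.
by rewrite linearN -derive1E'.
Qed.

Lemma c1_arc_sym x y (l : R) : c1_arc x y l -> c1_arc y x l.
Proof.
move=> [i [c [[dc cc] ci c0 c1 ->]]]; exists i, (c \o onem).
have dr t : derive1 (c \o onem) t = - derive1 c (onem t).
  by have [_] := is_derive_reverse (dc (onem t)); rewrite -derive1E.
split.
- split=> [t|]; first by have [] := is_derive_reverse (dc (onem t)).
  move=> t; have -> : derive1 (c \o onem) = fun t => - derive1 c (onem t).
    exact/funext.
  have co : {for t, continuous (derive1 c \o onem)}.
    apply: continuous_comp; last exact: cc.
    by apply: cvgB; [exact: cvg_cst|exact: cvg_id].
  exact: cvgN co.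
- move=> t /andP[t0 t1]; apply: ci; rewrite /onem.
  by rewrite subr_ge0 t1 lerBlDr lerDl t0.
- by rewrite /= onem0.
- by rewrite /= onem1.
have sc := speed_continuous dc cc ci.
etransitivity; first exact (Rintegral_reverse sc).
apply: eq_Rintegral => t _; rewrite dr /=.
by rewrite linearN mulNmx mulmxN mulNmx opprK.
Qed.

Lemma c1_arc_ge0 x y (l : R) : c1_arc x y l -> 0 <= l.
Proof.
move=> [i [c [_ _ _ _ ->]]]; apply: Rintegral_ge0 => t _; exact: sqrtr_ge0.
Qed.

Lemma curve_length_ge0 x y (l : R) : curve_of_length x y l -> 0 <= l.
Proof. by elim=> // *; rewrite addr_ge0//; apply: c1_arc_ge0; eassumption. Qed.

Lemma c1_arc_curve x y (l : R) : c1_arc x y l -> curve_of_length x y l.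
Proof. by move=> xy; rewrite -(addr0 l); apply: curve_cons xy (curve_nil _). Qed.

Lemma curve_cat x y z (l1 l2 : R) :
  curve_of_length x y l1 -> curve_of_length y z l2 ->
  curve_of_length x z (l1 + l2).
Proof.
move=> xy; elim: xy l2 z => [x'|x' y' z' l l' xy _ IH] l2 z zz.
  by rewrite add0r.
by rewrite -addrA; apply: curve_cons xy (IH _ _ zz).
Qed.

Lemma curve_sym x y (l : R) : curve_of_length x y l -> curve_of_length y x l.
Proof.
elim=> [x'|x' y' z' l1 l2 xy _ IH]; first exact: curve_nil.
by rewrite addrC; apply: curve_cat IH _; exact/c1_arc_curve/c1_arc_sym.
Qed.

(** The arc is the straight segment in the chart. The entries of the metric are
    bounded near the point, so the speed is at most a constant times the norm
    of the direction of the segment. *)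
Lemma short_segment i x : dom i x -> exists2 K : R, 0 < K &
  \forall q \near coord i x,
    exists2 l, c1_arc x (param i q) l & l <= K * `|q - coord i x|.
Proof.
move=> xi; set a := coord i x.
have ai : (coord i @` dom i) a by exists x.
pose S (q : 'rV[R]_N) := \sum_j \sum_k `|metric i (param i q) k j|.
have Sge0 q : 0 <= S q by apply: sumr_ge0 => j _; apply: sumr_ge0.
have cS : {for a, continuous S}.
  apply: (@cvg_sum_ord _ _ (nbhs a) _) => j.
  apply: (@cvg_sum_ord _ _ (nbhs a) _) => k.
  by apply: cvg_norm; exact: metric_continuous ai.
pose K := Num.sqrt (S a + 1).
exists K; first by rewrite sqrtr_gt0 ltr_wpDl.
have : \forall q \near a, (coord i @` dom i) q /\ S q < S a + 1.
  apply: filterI; first by apply: open_nbhs_nbhs; split => //; exact: codom_open.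
  by apply: (cvgr_lt (S a) cS); rewrite ltrDl.
move=> /nbhs_ballP[e /= e0 He].
apply/nbhs_ballP; exists e => // q; rewrite -ball_normE /= => qa.
(* Balls of the chart coordinates are convex, so the segment stays in the
   chart and in the region where S is controlled. *)
pose v := q - a.
pose c (t : R) := a + t *: v.
have dc t : is_derive t (1 : R) c v.
  have cv : h^-1 *: ((c \o shift t) (h *: (1 : R)) - c t) @[h --> 0^'] --> v.
    apply: cvg_near_cst; near=> h.
    rewrite /c /= opprD addrACA subrr add0r -scalerBl addrK.
    rewrite [h *: 1]mulr1 scalerA mulVf ?scale1r//.
    by near: h; exact: nbhs_dnbhs_neq.
  by apply: DeriveDef; [apply/cvg_ex; exists v|exact: cvg_lim cv].
have dcE : derive1 c = cst v.
  by apply/funext => t; rewrite derive1E derive_val.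
have cb t : 0 <= t <= 1 -> ball a e (c t).
  move=> /andP[t0 t1]; rewrite -ball_normE /= /c opprD addNKr normrN normrZ.
  rewrite ger0_norm//; apply: le_lt_trans qa; rewrite distrC.
  by rewrite ler_piMl.
have ci t : 0 <= t <= 1 -> (coord i @` dom i) (c t).
  by move=> /cb /He[].
have dc' t : derivable c t 1 by [].
have cc : continuous (derive1 c) by rewrite dcE => t; exact: cvg_cst.
exists (\int[lebesgue_measure]_(t in `[0, 1]) speed i c t).
  exists i, c; split.
  - exact (conj dc' cc).
  - exact: ci.
  - by rewrite /c scale0r addr0 coordK.
  - by rewrite /c scale1r /v addrCA subrr addr0.
  - exact: erefl.
have -> : K * `|q - a| =
    \int[lebesgue_measure]_(t in `[0, 1]) (K * `|v|).
  by rewrite Rintegral_cst//= lebesgue_measure_itv/= lte01 sube0 mulr1.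
apply: le_Rintegral => //.
- exact (continuous_compact_integrable (@segment_compact _ _ _)
           (speed_continuous dc' cc ci)).
- apply: continuous_compact_integrable; first exact: segment_compact.
  by move=> t; exact: cvg_cst.
move=> t t01; rewrite /speed dcE /= mx_quadratic_formE.
have [_ St] := He _ (cb _ t01).
have -> : K * `|v| = Num.sqrt ((S a + 1) * `|v| ^+ 2).
  by rewrite sqrtrM ?addr_ge0// sqrtr_sqr normr_id.
rewrite ler_wsqrtr//.
have vle k : `|v 0 k| <= `|v|.
  rewrite [leRHS]/Num.Def.normr /= mx_normrE.
  exact: (le_bigmax _ (fun ij => `|v ij.1 ij.2|) (0, k)).
apply: (@le_trans _ _ (S (c t) * `|v| ^+ 2)); last first.
  by apply: ler_wpM2r; [exact: sqr_ge0|exact: ltW].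
apply: le_trans (ler_norm _) _; apply: le_trans (ler_norm_sum _ _ _) _.
rewrite mulr_suml; apply: ler_sum => j _.
rewrite expr2 mulrA normrM; apply: ler_pM => //.
apply: le_trans (ler_norm_sum _ _ _) _.
rewrite mulr_suml; apply: ler_sum => k _.
by rewrite normrM mulrC ler_wpM2l.
Unshelve. all: by end_near. Qed.

End curves.

(** * Riemannian distance and cutoff functions *)

Section distance.
Context {R : realType} {N : nat} {M : riemannian_manifold R N}.
Implicit Types (i : chart M) (x y z : M).

Lemma near_coord i x (P : 'rV[R]_N -> Prop) : dom i x ->
  (\forall q \near coord i x, P q) ->
  \forall y \near x, dom i y /\ P (coord i y).
Proof.
move=> xi Pq; apply: filterI.
  by apply: open_nbhs_nbhs; split=> //; exact: dom_open.
have := @coord_continuous _ _ M i.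
rewrite continuous_open_subspace; last exact: dom_open.
by move=> /(_ x); rewrite inE => /(_ xi) /(_ _ Pq).
Qed.

Lemma near_curve x : \forall y \near x, exists l, curve_of_length x y l.
Proof.
have xi := chart_at_dom x.
have [K _ segK] := short_segment xi.
have := near_coord xi segK; apply: filterS => y [yi [l xy _]].
by exists l; rewrite -(coordK yi); exact: c1_arc_curve.
Qed.

(** The set of the points that can be reached from x is open by [near_curve];
    it is closed by [near_curve] at a limit point and reversal of curves. *)
Lemma curve_exists x y : exists l, curve_of_length x y l.
Proof.
pose S : set M := [set y | exists l, curve_of_length x y l].
suff : S = setT by move=> ST; have : S y by rewrite ST.
apply: (@rm_connected _ _ M S).
- by exists x, 0; exact: curve_nil.
- exists S; last by rewrite setTI.
  rewrite openE => z [l xz]; have := near_curve z.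
  by apply: filterS => w [l' zw]; exists (l + l'); exact: curve_cat xz zw.
- exists S; last by rewrite setTI.
  move=> z Sz; have [w [[l xw] [l' zw]]] := Sz _ (near_curve z).
  by exists (l + l'); apply: curve_cat xw (curve_sym zw).
Qed.

(** Without a curve between the points the infimum would be 0 by convention, and
    the triangle inequality could fail. *)
Lemma has_inf_length x y : has_inf [set l | curve_of_length x y l].
Proof.
split; first exact: curve_exists.
by exists 0 => l; exact: curve_length_ge0.
Qed.

Lemma rdist_le x y (l : R) : curve_of_length x y l -> rdist x y <= l.
Proof. by move=> xy; apply: inf_lbound => //; have [] := has_inf_length x y. Qed.

Lemma le_rdist x y (r : R) :
  (forall l, curve_of_length x y l -> r <= l) -> r <= rdist x y.
Proof. by move=> rl; apply: lb_le_inf => //; have [] := has_inf_length x y. Qed.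

Lemma rdist_ge0 x y : 0 <= rdist x y.
Proof. by apply: le_rdist => l; exact: curve_length_ge0. Qed.

Lemma rdist_sym x y : rdist x y = rdist y x.
Proof.
by apply/eqP; rewrite eq_le; apply/andP; split;
  apply: le_rdist => l /curve_sym; exact: rdist_le.
Qed.

Lemma rdist_triangle x y z : rdist x z <= rdist x y + rdist y z.
Proof.
rewrite -lerBlDl; apply: le_rdist => l2 yz.
rewrite lerBlDl -lerBlDr; apply: le_rdist => l1 xy.
by rewrite lerBlDr; apply: rdist_le; exact: curve_cat xy yz.
Qed.

Lemma rdist_lipschitz x y z : `|rdist x y - rdist x z| <= rdist y z.
Proof.
have xyz := rdist_triangle x y z; have := rdist_triangle x z y.
by rewrite (rdist_sym z y) ler_norml => xzy; apply/andP; split; lra.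
Qed.

(** Balls are open, as seen from a chart: segments to nearby points are
    short. *)
Lemma near_param_rdist i x x0 (r : R) : dom i x -> rdist x0 x < r ->
  \forall q \near coord i x, rdist x0 (param i q) < r.
Proof.
move=> xi xr; have [K K0 segK] := short_segment xi.
have rK0 : 0 < (r - rdist x0 x) / K by rewrite divr_gt0// subr_gt0.
have near_x : \forall q \near coord i x, `|q - coord i x| < (r - rdist x0 x) / K.
  apply/nbhs_ballP; exists ((r - rdist x0 x) / K) => // q.
  by rewrite -ball_normE /= distrC.
apply: filterS2 segK near_x => q [l xq lK] qx.
apply: le_lt_trans (rdist_triangle x0 x _) _.
rewrite -ltrBrDl; apply: le_lt_trans (rdist_le (c1_arc_curve xq)) _.
by apply: le_lt_trans lK _; rewrite mulrC -ltr_pdivlMr.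
Qed.

Definition cutoff x0 (r : R) (x : M) : R :=
  Num.max 0 (Num.min 1 (r + 1 - rdist x0 x)).

Lemma cutoff1 x0 (r : R) x : rdist x0 x <= r -> cutoff x0 r x = 1.
Proof.
move=> xr; rewrite /cutoff min_l ?max_r//.
by rewrite lerBrDr [leRHS]addrC lerD2l.
Qed.

Lemma cutoff_test x0 (r : R) : space_test x0 (cutoff x0 r).
Proof.
split.
  exists 1 => x y; rewrite mul1r; apply: le_trans (rdist_lipschitz x0 x y).
  rewrite /cutoff; move: (rdist x0 x) (rdist x0 y) => a b.
  (* Truncation does not increase the difference of two numbers. *)
  have := ler_norm (a - b); have := ler_norm (b - a); rewrite (distrC b a).
  move: `|a - b| => c; rewrite ler_norml /Num.max /Num.min.
  by case: ifP; case: ifP; case: ifP; case: ifP => *; apply/andP; split; lra.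
exists (r + 1) => x xr; rewrite /cutoff min_r ?max_l//; lra.
Qed.

Lemma differential_cutoff x0 (r : R) i x : dom i x -> rdist x0 x < r ->
  differential (cutoff x0 r) i x = 0.
Proof.
move=> xi xr; apply/rowP => a; rewrite !mxE.
have one : \forall q \near coord i x,
    (cutoff x0 r \o param i) q = cst (1 : R) q.
  have := near_param_rdist xi xr.
  by apply: filterS => q qr /=; apply: cutoff1; exact: ltW.
by rewrite (near_eq_derive _ one) derive_cst.
Qed.

End distance.

(** * Conservation of mass *)

Section mass.
Context {R : realType} {N : nat} {M : riemannian_manifold R N}.
Context (mu : {measure set (borel M) -> \bar R}) (x0 : M).
Implicit Types (r : R) (f rho : M -> R).

Lemma ae_zero_or_in_ball r f : ess_support mu f `<=` rball x0 r ->
  {ae mu, forall x, f x = 0 \/ rdist x0 x < r}.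
Proof.
move=> fr; apply: (ae_impl (ae_zero_outside_ess_support mu f)) => x fx.
have [/fr|/fx] := pselect (ess_support mu f x); first by right.
by left.
Qed.

Lemma integral_cutoff rho r f : ess_support mu f `<=` rball x0 r ->
  (\int[mu]_x (rho x * f x * cutoff x0 r x)%:E = \int[mu]_x (rho x * f x)%:E)%E.
Proof.
move=> /ae_zero_or_in_ball fr; apply: ae_eq_integralT.
apply: (ae_impl fr) => x [->|/ltW xr]; first by rewrite mulr0 mul0r.
by rewrite cutoff1// mulr1.
Qed.

Lemma Lnorm1_density rho f : (forall x, 0 <= rho x) -> (forall x, 0 <= f x) ->
  ('N[mu]_1[EFin \o (fun x => f x * rho x)%R] = \int[mu]_x (rho x * f x)%:E)%E.
Proof.
move=> rho0 f0; rewrite Lnorm1; apply: eq_integral => x _.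
by rewrite /= ger0_norm ?mulr_ge0// mulrC.
Qed.

(** Needed since the weak formulation only equates real-valued integrals, which
    do not see whether a mass is infinite. *)
Lemma mass_fin_num rho r f : (forall x, 0 <= rho x) -> (forall x, 0 <= f x) ->
  ess_support mu f `<=` rball x0 r ->
  mu.-integrable (rball x0 r) (fun x => (rho x * f x)%:E) ->
  (\int[mu]_x (rho x * f x)%:E)%E \is a fin_num.
Proof.
move=> rho0 f0 /ae_zero_or_in_ball fr /integrableP[_ fin].
rewrite ge0_fin_numE; last first.
  by apply: integral_ge0 => x _; rewrite lee_fin mulr_ge0.
apply: le_lt_trans fin; rewrite [leRHS]integral_mkcond.
rewrite le_eqVlt; apply/orP; left; apply/eqP/ae_eq_integralT.
apply: (ae_impl fr) => x fx; rewrite patchE; case: ifPn => [_|].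
  by rewrite /= ger0_norm ?mulr_ge0.
rewrite notin_setE /rball /= => xr.
by case: fx => [->|//]; rewrite mulr0.
Qed.

(** The gradient vanishes where f = 0, and the differential of the cutoff
    vanishes in the ball; up to a null set there is no other point. *)
Lemma flux_cutoff0 (p m r : R) f (w : covectors M) :
  (forall i x, dom i x -> f x = 0 -> w i x = 0) ->
  ess_support mu f `<=` rball x0 r ->
  {ae mu, forall x, f x `^ (m - 1) * conorm w x `^ (p - 2)
     * codot w (differential (cutoff x0 r)) x = 0}.
Proof.
move=> w0 /ae_zero_or_in_ball fr; apply: (ae_impl fr) => x fx.
suff -> : codot w (differential (cutoff x0 r)) x = 0 by rewrite mulr0.
rewrite /codot; have xi := chart_at_dom x; case: fx => [fx0|xr].
  by rewrite w0// !mul0mx mxE.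
by rewrite differential_cutoff// trmx0 mulmx0 mxE.
Qed.

(** The weak formulation with a test function that does not depend on time: both
    terms under the time integral vanish. *)
Lemma mass_cutoff_cst (p m r T : R) rho u0 (u : R -> M -> R) (t1 t2 : R) :
  weak_solution mu x0 p m rho u0 u ->
  (forall t, 0 < t -> t < T -> ess_support mu (u t) `<=` rball x0 r) ->
  0 < t1 -> t1 < t2 -> t2 < T ->
  \int[mu]_x (rho x * u t2 x * cutoff x0 r x) =
  \int[mu]_x (rho x * u t1 x * cutoff x0 r x).
Proof.
move=> [_ _ _ [Du [[_ _ Du0 _] _ _ weak]] _] supp t10 t12 t2T.
have test : spacetime_test x0 (fun=> cutoff x0 r).
  have [[L lip] bd] := cutoff_test x0 r; split; last first.
    by have [r' hr'] := bd; exists r' => _; exact: hr'.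
  (* The absolute value keeps the term in |s - t| nonnegative. *)
  exists `|L| => s t x y; apply: le_trans (lip x y) _.
  apply: le_trans (ler_wpM2r (rdist_ge0 x y) (ler_norm L)) _.
  by rewrite ler_wpM2l// lerDr.
rewrite -(weak _ _ _ test t10 t12) [X in _ + X](_ : _ = 0) ?addr0//.
transitivity (\int[lebesgue_measure]_(t in `[t1, t2]) (cst (0 : R) t)).
  apply: eq_Rintegral => t; rewrite inE /= in_itv /= => /andP[t1t tt2].
  have t0 : 0 < t by exact: lt_le_trans t1t.
  have tT : t < T by exact: le_lt_trans t2T.
  rewrite /Rintegral (@ae_eq_integralT _ _ _ mu _ (cst 0%E)).
    by rewrite integral0.
  have := flux_cutoff0 p m (fun i x => Du0 t i x t0) (supp t t0 tT).
  move=> /ae_impl; apply => x flux0.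
  by rewrite derive1_cst mulr0 oppr0 add0r flux0.
by rewrite /Rintegral integral0.
Qed.

End mass.

Unset Implicit Arguments.

Theorem theorem1p2 (R : realType) (N : nat) (M : riemannian_manifold R N)
    (mu : {measure set (borel M) -> \bar R}) (x0 : M) (p m : R)
    (rho g Vinv : R -> R) (C2 c3 C4 C5 : R)
    (u0 : M -> R) (u : R -> M -> R) (R0 Rbar tbar : R)
    (hmu : riemannian_measure mu)
    (mu_infinite : mu setT = +oo%E)
    (hp1 : 1 < p) (hpN : p < N%:R) (hpm : 3 < p + m)
    (rho_bounded : exists K : R, forall r : R, 0 <= r -> rho r <= K)
    (rho_pos : forall r : R, 0 <= r -> 0 < rho r)
    (rho_noninc : forall r s : R, 0 <= r -> r <= s -> rho s <= rho r)
    (g_nondec : forall v w : R, 0 <= v -> v <= w -> g v <= g w)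
    (g_isop : isoperimetric mu x0 g)
    (omega_cont : {within `[0, +oo[, continuous (omega N g)})
    (omega_nondec : forall v w : R, 0 <= v -> v <= w -> omega N g v <= omega N g w)
    (hVinv : inverse_volume mu x0 Vinv)
    (hC2 : 1 < C2) (hc3 : 0 < c3) (hC4 : 1 < C4) (hC5 : 1 < C5)
    (V_doubling : forall r : R, 0 < r ->
       (volume mu x0 (2 * r) <= C2%:E * volume mu x0 r)%E)
    (g_V : forall r : R, 0 < r ->
       c3 * fine (volume mu x0 r) / r <= g (fine (volume mu x0 r)))
    (Vinv_int : forall s : R, 0 < s ->
       (\int[@lebesgue_measure R]_(tau in `]0%R, s[) (Vinv tau `^ (- p))%:E
          <= (C4 * s * Vinv s `^ (- p))%:E)%E)
    (rho_doubling : forall r : R, 0 < r -> C5^-1 * rho r <= rho (2 * r))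
    (u0_ge0 : forall x, 0 <= u0 x)
    (u0_L1 : mu.-integrable setT
               (fun x => (rho (rdist x0 x) * u0 x)%:E))
    (R0_gt0 : 0 < R0)
    (u0_supp : ess_support mu u0 `<=` rball x0 R0)
    (hu : weak_solution mu x0 p m (fun x => rho (rdist x0 x)) u0 u)
    (tbar_gt0 : 0 < tbar) (hRbar : R0 < Rbar)
    (u_supp : forall t : R, 0 < t -> t < tbar ->
       ess_support mu (u t) `<=` rball x0 Rbar) :
  forall t : R, 0 < t -> t < tbar ->
    ('N[mu]_1[EFin \o (fun x => u t x * rho (rdist x0 x))%R] =
     'N[mu]_1[EFin \o (fun x => u0 x * rho (rdist x0 x))%R])%E.
Proof.
have rho0 x : 0 <= rho (rdist x0 x) by apply/ltW/rho_pos; exact: rdist_ge0.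
have [u_ge0 _ u_int _ u_init] := hu.
have u0_supp' : ess_support mu u0 `<=` rball x0 Rbar.
  by move=> x /u0_supp /lt_trans; apply.
pose I (f : M -> R) := \int[mu]_x (rho (rdist x0 x) * f x * cutoff x0 Rbar x).
have IE (f : M -> R) : ess_support mu f `<=` rball x0 Rbar ->
    I f = fine (\int[mu]_x (rho (rdist x0 x) * f x)%:E)%E.
  by move=> fR; rewrite /I /Rintegral -(integral_cutoff _ fR).
move=> t t0 tT.
have It : I (u t) = I u0.
  have to_u0 : I (u s) @[s --> 0^'+] --> I u0.
    by apply: u_init; exact: cutoff_test.
  apply: (cvg_unique (@norm_hausdorff _ _) _ to_u0).
  apply: cvg_near_cst; near=> s; apply/esym.
  have s0 : 0 < s by [].
  have st : s < t by near: s; exact: nbhs_right_lt.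
  exact: mass_cutoff_cst hu u_supp s0 st tT.
rewrite !Lnorm1_density//; last by move=> x; exact: u_ge0.
have fin_ut := mass_fin_num rho0 (fun x => u_ge0 t x t0) (u_supp t t0 tT)
  (proj1 (u_int Rbar t t0)).
have fin_u0 : (\int[mu]_x (rho (rdist x0 x) * u0 x)%:E)%E \is a fin_num.
  exact: integrable_fin_num u0_L1.
by rewrite -(fineK fin_ut) -(fineK fin_u0) -!IE ?It//; exact: u_supp.
Unshelve. all: by end_near. Qed.
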